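(* Let $H\le F_n$ be a finitely generated subgroup and let $g\in F_n$ be an element that depends on $H$. Let $D_g=\{d\in\mathbb N : \mathfrak I_g \text{ contains a non-trivial equation of degree } d\}$. Then exactly one of the following possibilities takes place: (i) $D_g$ contains an odd number and $\mathbb N\setminus D_g$ is finite. (ii) $D_g$ contains only even numbers and $2\mathbb N\setminus D_g$ is finite.
   Context: $\mathbb N=\{0,1,2,\dots\}$ and $2\mathbb N$ is the set of non-negative even numbers. $F_n$ is the free group with basis $a_1,\dots,a_n$. For a finitely generated subgroup $H\le F_n$ let $\langle x\rangle\cong\mathbb Z$ be infinite cyclic. An equation with coefficients in $H$ is an element $w\in H*\langle x\rangle$; it has a unique expression as a reduced word in the alphabet $\{x,x^{-1}\}\cup (H\setminus\{1\})$. The degree of $w$ is the number of occurrences of $x$ and $x^{-1}$ in the cyclic reduction of $w$. For $g\in F_n$ let $\varphi_g:H*\langle x\rangle\to F_n$ be the homomorphism that is the inclusion on $H$ and sends $x$ to $g$, and let $\mathfrak I_g=\ker\varphi_g$, a normal subgroup of $H*\langle x\rangle$. We say $g$ depends on $H$ if $\mathfrak I_g$ is non-trivial. *)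

(* Defs.v *)
From HB Require Import structures.
From mathcomp Require Import all_boot.
From mathcomp Require Import classical_sets cardinality.

Set Implicit Arguments.
Unset Strict Implicit.
Unset Printing Implicit Defensive.

Local Open Scope group_scope.

(* The free group on [X] is the set of reduced words over [X * bool], where the
   letter [(i, true)] stands for [a_i] and [(i, false)] for [a_i^-1]. *)

Section FreeGroup.
Variable X : choiceType.
Implicit Types (l m : X * bool) (s t u : seq (X * bool)).

Definition flip l := (l.1, ~~ l.2).

Definition freely_reduced s := sorted (fun l m => m != flip l) s.

Record freegroup := FreeGroup {
  fg_word :> seq (X * bool);
  fg_reduced : freely_reduced fg_word
}.

HB.instance Definition _ := [isSub for fg_word].
HB.instance Definition _ := [Choice of freegroup by <:].

Definition fg_push l s :=
  if s is m :: s' then if m == flip l then s' else l :: s else [:: l].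

Definition fg_cat s t := foldr fg_push t s.

Lemma flipK : involutive flip.
Proof. by case=> i b; rewrite /flip /= negbK. Qed.

Lemma fg_push_reduced l s : freely_reduced s -> freely_reduced (fg_push l s).
Proof.
case: s => [//|m s] /= ms; case: ifPn => [_|ml] /=; first exact: path_sorted ms.
by rewrite ml.
Qed.

Lemma fg_cat_reduced s t : freely_reduced t -> freely_reduced (fg_cat s t).
Proof. by move=> rt; elim: s => //= l s; apply: fg_push_reduced. Qed.

Lemma fg_pushK l s : freely_reduced s -> fg_push (flip l) (fg_push l s) = s.
Proof.
case: s => [|m s] /=; first by rewrite flipK eqxx.
case: (eqVneq m (flip l)) => [->|ml] /= rs; last by rewrite flipK eqxx.
case: s rs => [//|k s] /= /andP[kl _]; by rewrite (negbTE kl).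
Qed.

Lemma fg_push_cat l s t : freely_reduced s -> freely_reduced t ->
  fg_cat (fg_push l s) t = fg_push l (fg_cat s t).
Proof.
case: s => [//|m s] /= rs rt; case: (eqVneq m (flip l)) => [->|//].
have /(fg_pushK (flip l)) : freely_reduced (fg_cat s t) by apply: fg_cat_reduced.
by rewrite flipK.
Qed.

Lemma fg_catA s t u : freely_reduced t -> freely_reduced u ->
  fg_cat s (fg_cat t u) = fg_cat (fg_cat s t) u.
Proof.
move=> rt ru; elim: s => //= l s ->.
by rewrite fg_push_cat //; apply: fg_cat_reduced.
Qed.

Lemma fg_cats0 s : freely_reduced s -> fg_cat s [::] = s.
Proof.
elim: s => //= l s IHs ls; rewrite IHs; last exact: path_sorted ls.
by case: s ls {IHs} => //= m s /andP[/negbTE ->].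
Qed.

Definition fg_winv s := rev (map flip s).

Lemma fg_winv_reduced s : freely_reduced s -> freely_reduced (fg_winv s).
Proof.
rewrite /freely_reduced /fg_winv rev_sorted sorted_map.
apply: sub_sorted => l m /=; apply: contraNneq => ml.
by rewrite -[m]flipK -ml.
Qed.

Lemma fg_catVs s : fg_cat (fg_winv s) s = [::].
Proof.
elim: s => // l s IHs; rewrite /fg_winv /= rev_cons /fg_cat foldr_rcons /=.
by rewrite flipK eqxx.
Qed.

Lemma fg_winvK : involutive fg_winv.
Proof.
by move=> s; rewrite /fg_winv map_rev revK mapK //; exact: flipK.
Qed.

Definition fg_mul (x y : freegroup) : freegroup :=
  FreeGroup (fg_cat_reduced x (fg_reduced y)).
Definition fg_one : freegroup := @FreeGroup [::] isT.
Definition fg_inv (x : freegroup) : freegroup :=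
  FreeGroup (fg_winv_reduced (fg_reduced x)).

Fact fg_mulA : associative fg_mul.
Proof. by move=> x y z; apply: val_inj; apply: fg_catA; apply: fg_reduced. Qed.

Fact fg_mul1 : left_id fg_one fg_mul.
Proof. by move=> x; apply: val_inj. Qed.

Fact fg_mulx1 : right_id fg_one fg_mul.
Proof. by move=> x; apply: val_inj; apply: fg_cats0; apply: fg_reduced. Qed.

Fact fg_mulV : left_inverse fg_one fg_inv fg_mul.
Proof. by move=> x; apply: val_inj; apply: fg_catVs. Qed.

Fact fg_mulxV : right_inverse fg_one fg_inv fg_mul.
Proof.
move=> x; apply: val_inj; rewrite /= -{1}[fg_word x]fg_winvK; exact: fg_catVs.
Qed.

HB.instance Definition _ :=
  isGroup.Build freegroup fg_mulA fg_mul1 fg_mulx1 fg_mulV fg_mulxV.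

Definition fg_gen (i : X) : freegroup := @FreeGroup [:: (i, true)] isT.

Lemma fg_prod_gen (x : freegroup) :
  x = \prod_(l <- x) (if l.2 then fg_gen l.1 else (fg_gen l.1)^-1).
Proof.
case: x => s rs; apply: val_inj => /=.
elim: s rs => [|l s IHs] ls; first by rewrite big_nil.
have rs := path_sorted ls; rewrite big_cons.
have -> (y : freegroup) : fg_word ((if l.2 then fg_gen l.1 else (fg_gen l.1)^-1) * y)
    = fg_push l y by case: l {ls} => i [].
rewrite -(IHs rs) /=; case: s ls {rs IHs} => //= m s /andP[/negbTE -> //].
Qed.

End FreeGroup.

Inductive generated (G : groupType) (s : seq G) : G -> Prop :=
| generated_in x of x \in s : generated s x
| generated1 : generated s 1
| generatedM x y of generated s x & generated s y : generated s (x * y)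
| generatedV x of generated s x : generated s x^-1.

Definition finitely_generated (G : groupType) (H : {pred G}) :=
  exists s : seq G, forall x, x \in H <-> generated s x.

Fact groupClosed_closed (G : groupType) (H : groupClosed G) : group_closed H.
Proof. by split; [apply: gpred1 | move=> x y Hx Hy; apply: gpredF]. Qed.

Definition subgroup_of (G : groupType) (H : groupClosed G) := {x : G | x \in H}.

HB.instance Definition _ (G : groupType) (H : groupClosed G) :=
  SubChoice.on (subgroup_of H).
HB.instance Definition _ (G : groupType) (H : groupClosed G) :=
  SubChoice_isSubGroup.Build G (mem H) (subgroup_of H) (groupClosed_closed H).

(* [equation H] is the free product [H * <x>], as the set of reduced words over
   [H + bool]: the letter [inl h] stands for [h], [inr true] for [x] and
   [inr false] for [x^-1].  A word is reduced when it has no letter [inl 1], no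
   two consecutive letters from [H], and no factor [x x^-1] or [x^-1 x]. *)

Section Equations.
Variable H : groupType.
Implicit Types (l m : H + bool) (s t u : seq (H + bool)).

Definition can_follow l m :=
  match l, m with
  | inl _, inl _ => false
  | inr e, inr f => e == f
  | _, _ => true
  end.

Definition eq_reduced s := (inl 1 \notin s) && sorted can_follow s.

Record equation := Equation {
  eq_word :> seq (H + bool);
  eq_reducedP : eq_reduced eq_word
}.

HB.instance Definition _ := [isSub for eq_word].
HB.instance Definition _ := [Choice of equation by <:].

Definition eq_pushH (h : H) s :=
  if h == 1 then s else
  if s is inl k :: s' then
    if h * k == 1 then s' else inl (h * k) :: s'
  else inl h :: s.

Definition eq_pushx (e : bool) s :=
  if s is inr f :: s' then if e == f then inr e :: s else s' else inr e :: s.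

Definition eq_push l s :=
  match l with inl h => eq_pushH h s | inr e => eq_pushx e s end.

Definition eq_cat s t := foldr eq_push t s.

Lemma eq_reduced_cons l s :
  eq_reduced (l :: s) =
  [&& l != inl 1, (if s is m :: _ then can_follow l m else true) & eq_reduced s].
Proof.
rewrite /eq_reduced inE negb_or eq_sym; case: s => [|m s] /=; first by rewrite !andbT.
by rewrite -andbA; case: (l != _); case: can_follow; rewrite ?andbF.
Qed.

Lemma inlE (h k : H) : (inl h == inl k :> H + bool) = (h == k).
Proof. by []. Qed.

Lemma eq_push_reduced l s : eq_reduced s -> eq_reduced (eq_push l s).
Proof.
case: l => [h|e] /=.
  rewrite /eq_pushH; case: (eqVneq h 1) => // h1.
  case: s => [|[k|f] s].
  - by rewrite eq_reduced_cons inlE h1.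
  - by case: (eqVneq (h * k) 1) => hk; rewrite !eq_reduced_cons !inlE => /and3P[_ sk rs] //;
      rewrite hk rs andbT.
  - by move=> rs; rewrite eq_reduced_cons rs inlE h1.
rewrite /eq_pushx; case: s => [|[k|f] s] rs; try by rewrite eq_reduced_cons ?rs.
case: (eqVneq e f) => ef; first by rewrite eq_reduced_cons rs /= ef eqxx.
by move: rs; rewrite eq_reduced_cons => /and3P[].
Qed.

Lemma eq_cat_reduced s t : eq_reduced t -> eq_reduced (eq_cat s t).
Proof. by move=> rt; elim: s => //= l s; apply: eq_push_reduced. Qed.

Lemma eq_pushHM h k s : eq_reduced s ->
  eq_pushH h (eq_pushH k s) = eq_pushH (h * k) s.
Proof.
rewrite /eq_pushH; case: (eqVneq k 1) => [->|k1 rs]; first by rewrite mulg1.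
case: (eqVneq h 1) => [->|h1]; first by rewrite mul1g (negbTE k1).
case: s rs => [|[a|f] s] //= rs.
- case: (eqVneq (k * a) 1) => ka.
    case: (eqVneq (h * k) 1) => hk.
      have -> : a = h by rewrite -[h]mulg1 -ka mulgA hk mul1g.
      by case: s rs => [|[b|f] s] //; rewrite eq_reduced_cons /= andbF.
    rewrite -mulgA ka mulg1 (negbTE h1).
    by case: s rs => [|[b|f] s] //; rewrite eq_reduced_cons /= andbF.
  case: (eqVneq (h * k) 1) => hk; last by rewrite mulgA.
  rewrite mulgA hk mul1g.
  by move: rs; rewrite eq_reduced_cons inlE => /and3P[/negbTE -> _ _].
Qed.

Lemma eq_pushxK e s : eq_reduced s -> eq_pushx (~~ e) (eq_pushx e s) = s.
Proof.
rewrite /eq_pushx; case: s => [|[k|f] s] /=; try by case: e.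
case: (eqVneq e f) => [->|ef] /=; first by case: f.
have -> : f = ~~ e by case: e f ef => [] [].
by case: s => [|[b|f'] s] //; rewrite eq_reduced_cons => /and3P[_ /= -> _].
Qed.

Lemma eq_push_cat l s t : eq_reduced s -> eq_reduced t ->
  eq_cat (eq_push l s) t = eq_push l (eq_cat s t).
Proof.
move=> rs rt; case: l => [h|e] /=.
  case: (eqVneq h 1) => [->|h1]; first by rewrite /eq_pushH eqxx.
  case: s rs => [|[k|f] s] rs; try by rewrite {1}/eq_pushH (negbTE h1).
  rewrite /= eq_pushHM; last exact: eq_cat_reduced.
  rewrite {1}/eq_pushH (negbTE h1); case: (eqVneq (h * k) 1) => hk //=.
  by rewrite hk /eq_pushH eqxx.
case: s rs => [|[k|f] s] rs //=.
case: (eqVneq e f) => //= ef; have -> : f = ~~ e by case: e f ef {rs} => [] [].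
have /(eq_pushxK (~~ e)) : eq_reduced (eq_cat s t) by apply: eq_cat_reduced.
by rewrite negbK.
Qed.

Lemma eq_catA s t u : eq_reduced t -> eq_reduced u ->
  eq_cat s (eq_cat t u) = eq_cat (eq_cat s t) u.
Proof.
move=> rt ru; elim: s => //= l s ->.
by rewrite eq_push_cat //; apply: eq_cat_reduced.
Qed.

Lemma eq_push_cons l s : eq_reduced (l :: s) -> eq_push l s = l :: s.
Proof.
rewrite eq_reduced_cons => /and3P[l1 ls _].
case: l l1 ls => [h|e] /= l1 ls.
  by rewrite /eq_pushH -inlE (negbTE l1); case: s ls => [|[]].
by rewrite /eq_pushx; case: s ls => [|[k|f] s] //= /eqP ->; rewrite eqxx.
Qed.

Lemma eq_cats0 s : eq_reduced s -> eq_cat s [::] = s.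
Proof.
elim: s => //= l s IHs rls; rewrite IHs ?eq_push_cons //.
by move: rls; rewrite eq_reduced_cons => /and3P[].
Qed.

Definition linv l : H + bool :=
  match l with inl h => inl h^-1 | inr e => inr (~~ e) end.

Lemma linvK : involutive linv.
Proof. by case=> [h|e] /=; rewrite ?invgK ?negbK. Qed.

Definition eq_winv s := rev (map linv s).

Lemma eq_winvK : involutive eq_winv.
Proof. by move=> s; rewrite /eq_winv map_rev revK mapK //; exact: linvK. Qed.

Lemma eq_winv_reduced s : eq_reduced s -> eq_reduced (eq_winv s).
Proof.
rewrite /eq_reduced /eq_winv rev_sorted sorted_map mem_rev => /andP[s1 ss].
apply/andP; split.
  apply: contra s1 => /mapP[[h|//] hs [/esym/eqP]].
  by rewrite invg_eq1 => /eqP <-.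
by apply: sub_sorted ss => -[h|e] [k|f] //= /eqP ->.
Qed.

Lemma eq_pushK l s : eq_reduced s -> eq_push (linv l) (eq_push l s) = s.
Proof.
case: l => [h|e] rs /=; last exact: eq_pushxK.
by rewrite eq_pushHM // mulVg /eq_pushH eqxx.
Qed.

Lemma eq_catVs s : eq_reduced s -> eq_cat (eq_winv s) s = [::].
Proof.
elim: s => // l s IHs rls.
have rs : eq_reduced s by move: rls; rewrite eq_reduced_cons => /and3P[].
rewrite /eq_winv map_cons rev_cons /eq_cat foldr_rcons -(eq_push_cons rls).
by rewrite eq_pushK //; exact: IHs.
Qed.

Definition eq_mul (v w : equation) : equation :=
  Equation (eq_cat_reduced v (eq_reducedP w)).
Definition eq_one : equation := @Equation [::] isT.
Definition eq_inv (w : equation) : equation :=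
  Equation (eq_winv_reduced (eq_reducedP w)).

Fact eq_mulA : associative eq_mul.
Proof. by move=> x y z; apply: val_inj; apply: eq_catA; apply: eq_reducedP. Qed.

Fact eq_mul1 : left_id eq_one eq_mul.
Proof. by move=> x; apply: val_inj. Qed.

Fact eq_mulx1 : right_id eq_one eq_mul.
Proof. by move=> x; apply: val_inj; apply: eq_cats0; apply: eq_reducedP. Qed.

Fact eq_mulV : left_inverse eq_one eq_inv eq_mul.
Proof. by move=> x; apply: val_inj; apply: eq_catVs; apply: eq_reducedP. Qed.

Fact eq_mulxV : right_inverse eq_one eq_inv eq_mul.
Proof.
move=> x; apply: val_inj; rewrite /= -{1}[eq_word x]eq_winvK; apply: eq_catVs.
exact: eq_winv_reduced (eq_reducedP x).
Qed.

HB.instance Definition _ :=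
  isGroup.Build equation eq_mulA eq_mul1 eq_mulx1 eq_mulV eq_mulxV.

Definition eq_var : equation := @Equation [:: inr true] isT.
Definition eq_const (h : H) : equation :=
  Equation (eq_push_reduced (inl h) (isT : eq_reduced [::])).

(* In a word [l s z] the letters [z] and [l] become adjacent when the word is
   read cyclically: a step cancels [z l] if it is [x x^-1] or [x^-1 x], and
   merges [z] and [l] if both are in [H], dropping a trivial product.  A step
   that changes the word shortens it, so [size w] steps reach the fixpoint,
   which is cyclically reduced and conjugate to [w] (lemmas
   [cyclic_reductionP] and [cyclic_reduction_conj] below). *)

Definition cyclic_step s :=
  if s is l :: m :: t then
    match last m t, l with
    | inl k, inl h =>
        if k * h == 1 then belast m t else inl (k * h) :: belast m t
    | inr f, inr e => if f == e then s else belast m t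
    | _, _ => s
    end
  else s.

Lemma cyclic_step_rcons l z s :
  cyclic_step (l :: rcons s z) =
    match z, l with
    | inl k, inl h => if k * h == 1 then s else inl (k * h) :: s
    | inr f, inr e => if f == e then l :: rcons s z else s
    | _, _ => l :: rcons s z
    end.
Proof. by case: s => [|m s] //=; rewrite last_rcons belast_rcons. Qed.

Lemma eq_reduced_cat s t : eq_reduced (s ++ t) -> eq_reduced s /\ eq_reduced t.
Proof.
rewrite /eq_reduced mem_cat negb_or => /andP[/andP[-> ->]] /cat_sorted2.
by case.
Qed.

Lemma eq_cat_word s t : eq_reduced (s ++ t) -> eq_cat s t = s ++ t.
Proof.
elim: s => //= l s IHs rst; rewrite IHs ?eq_push_cons //.
by have [] := @eq_reduced_cat [:: l] (s ++ t) rst.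
Qed.

Lemma eq_reduced_inl h k s : k != 1 ->
  eq_reduced (inl h :: s) -> eq_reduced (inl k :: s).
Proof. by move=> k1; rewrite !eq_reduced_cons !inlE k1 => /and3P[_ -> ->]. Qed.

Lemma cyclic_step_reduced s : eq_reduced s -> eq_reduced (cyclic_step s).
Proof.
case: s => // l s; case/lastP: s => // s z rs; rewrite cyclic_step_rcons.
have rls : eq_reduced (l :: s).
  by move: rs; rewrite -cats1 -cat_cons => /eq_reduced_cat[].
have rs' : eq_reduced s by case: (@eq_reduced_cat [:: l] s rls).
case: z rs => [k|f]; case: l rls => [h|e] rls rs //; case: ifPn => // kh.
exact: eq_reduced_inl rls.
Qed.

Lemma cyclic_iter_reduced n (w : equation) : eq_reduced (iter n cyclic_step w).
Proof.
by elim: n => [|n] /=; [exact: eq_reducedP | exact: cyclic_step_reduced].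
Qed.

Definition cyclic_reduction (w : equation) : equation :=
  Equation (cyclic_iter_reduced (size w) w).

Definition is_var l := if l is inr _ then true else false.

Definition degree (w : equation) : nat := count is_var (cyclic_reduction w).

Definition cyclically_reduced s := forall i, eq_reduced (rot i s).

Lemma cyclic_step_size s : cyclic_step s = s \/ size (cyclic_step s) < size s.
Proof.
case: s => [|l s]; first by left.
case/lastP: s => [|s z]; first by left.
rewrite cyclic_step_rcons /= size_rcons; case: z => [k|f]; case: l => [h|e];
  try (by left); case: ifP => _; by [left | right].
Qed.

Lemma cyclic_step_fix s : eq_reduced s -> cyclic_step s = s ->
  cyclically_reduced s.
Proof.
case: s => [|l s]; first by move=> _ _ [].
case/lastP: s => [|s z]; first by move=> rl _ [|i].
move=> rs fixs i; case/andP: (rs) => s1 ss; apply/andP; split.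
  by rewrite mem_rot.
have : cycle can_follow (rot i (l :: rcons s z)).
  rewrite rot_cycle (cycle_path l) /= last_rcons; move: ss => /= ->; rewrite andbT.
  have := congr1 size fixs; rewrite cyclic_step_rcons.
  case: z {rs fixs s1} => [k|f]; case: l => [h|e] //=; case: ifP => //= _ /eqP;
  by rewrite size_rcons ltn_eqF.
by case: (rot i _) => //= m t; rewrite rcons_path => /andP[].
Qed.

Lemma cyclic_reductionP (w : equation) : cyclically_reduced (cyclic_reduction w).
Proof.
apply: cyclic_step_fix; first exact: eq_reducedP.
suff fixn n s : size s <= n ->
    cyclic_step (iter n cyclic_step s) = iter n cyclic_step s by apply: fixn.
elim: n s => [|n IHn] s.
  by rewrite leqn0 size_eq0 => /eqP ->.
move=> sn; have [fs|lt] := cyclic_step_size s.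
  by have -> : iter n.+1 cyclic_step s = s by elim: n.+1 => //= k ->.
rewrite iterSr; apply: IHn; rewrite -ltnS; apply: leq_trans lt sn.
Qed.

Lemma cyclic_step_conj (v w : equation) : eq_word v = cyclic_step w ->
  exists y, v = w ^ y.
Proof.
have idcase : eq_word v = w -> exists y, v = w ^ y.
  by move=> vw; exists 1; rewrite conjg1; apply: val_inj.
case: w idcase => [[|l s] rw] idcase; first exact: idcase.
case/lastP: s rw idcase => [|s z] rw idcase; first exact: idcase.
rewrite [eq_word (Equation _)]/= cyclic_step_rcons => vE.
have rz : eq_reduced [:: z].
  by have := rw; rewrite -cats1 -cat_cons => /eq_reduced_cat[].
have rsz : eq_reduced (s ++ [:: z]).
  by rewrite cats1; case: (@eq_reduced_cat [:: l] (rcons s z) rw).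
have z1 : if z is inl k then k != 1 else true.
  by case: (z) rz => // k; rewrite eq_reduced_cons => /andP[].
suff E : (Equation rz : equation) * Equation rw = v * Equation rz
      \/ eq_word v = Equation rw.
  case: E => [E|/idcase//]; exists (Equation rz)^-1.
  by rewrite /conjg invgK mulgA E mulgK.
case: z l rw vE idcase rz rsz z1 => [k|f] [h|e] rw vE _ rz rsz z1; try by right.
  left; apply: val_inj; rewrite /= vE /eq_pushH (negbTE z1).
  case: ifPn => kh; first by rewrite eq_cat_word // cats1.
  have r' : eq_reduced ((inl (k * h) :: s) ++ [:: inl k]).
    by rewrite cat_cons cats1; exact: eq_reduced_inl rw.
  by rewrite eq_cat_word // cat_cons cats1.
move: vE; case: ifPn => fe vE; first by right.
by left; apply: val_inj; rewrite /= vE (negbTE fe) eq_cat_word // cats1.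
Qed.

Lemma cyclic_reduction_conj (w : equation) : exists y, cyclic_reduction w = w ^ y.
Proof.
suff: forall n (v : equation), eq_word v = iter n cyclic_step w ->
  exists y, v = w ^ y by apply.
elim=> [|n IHn] v vE; first by exists 1; rewrite conjg1; apply: val_inj.
have [y yE] := IHn (Equation (cyclic_iter_reduced n w)) erefl.
have [z zE] := @cyclic_step_conj v (Equation (cyclic_iter_reduced n w)) vE.
by exists (y * z); rewrite conjgM -yE.
Qed.

End Equations.

Section Ideal.
Variables (G : groupType) (H : groupClosed G) (g : G).
Implicit Types (w : equation (subgroup_of H)).

Definition eval_letter (l : subgroup_of H + bool) : G :=
  match l with inl h => val h | inr e => if e then g else g^-1 end.

Definition eval w : G := \prod_(l <- w) eval_letter l.

Fact eval_letter1 : eval_letter (inl 1) = 1.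
Proof. exact: gmulf1. Qed.

Fact eval_letterM h k :
  eval_letter (inl (h * k)) = eval_letter (inl h) * eval_letter (inl k).
Proof. exact: gmulfM. Qed.

Fact eval_is_multiplicative : {morph eval : v w / v * w}.
Proof.
have pushE l (s : seq (subgroup_of H + bool)) :
    \prod_(m <- eq_push l s) eval_letter m =
    eval_letter l * \prod_(m <- s) eval_letter m.
  case: l => [h|e]; rewrite [eq_push _ _]/=.
    rewrite /eq_pushH; case: eqP => [->|_]; first by rewrite eval_letter1 mul1g.
    case: s => [|[k|f] s]; rewrite ?big_cons //.
    rewrite mulgA -eval_letterM; case: eqP => [->|_]; last by rewrite big_cons.
    by rewrite eval_letter1 mul1g.
  rewrite /eq_pushx; case: s => [|[k|f] s]; rewrite ?big_cons //=.
  case: eqP => [->|]; first by rewrite !big_cons.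
  by case: e f => [] [] // _; rewrite ?mulKg ?mulVKg.
move=> v w; rewrite /eval /=; elim: (eq_word v) => [|l s IHs] /=.
  by rewrite big_nil mul1g.
by rewrite pushE IHs big_cons mulgA.
Qed.

Fact eval1 : eval 1 = 1.
Proof. exact: big_nil. Qed.

HB.instance Definition _ :=
  isMultiplicative.Build (equation (subgroup_of H)) G eval eval_is_multiplicative.
HB.instance Definition _ :=
  Multiplicative_isUMagmaMorphism.Build (equation (subgroup_of H)) G eval eval1.

Lemma eval_var : eval (eq_var _) = g.
Proof. exact: big_seq1. Qed.

Lemma eval_const h : eval (eq_const h) = val h.
Proof.
rewrite /eval /= /eq_pushH; case: eqP => [->|_]; last exact: big_seq1.
by rewrite big_nil -eval_letter1.
Qed.

(* The kernel [I_g] of the evaluation morphism [x |-> g]. *)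
Definition ideal : set (equation (subgroup_of H)) := [set w | eval w = 1].

Definition depends_on := exists2 w, ideal w & w != 1.

Definition ideal_degrees : set nat :=
  [set d | exists w, [/\ ideal w, w != 1 & degree w = d]].

End Ideal.

(* Main.v *)
(* A non-trivial cyclically reduced [v] in the kernel that is not a power of [x]
   can be rotated so as to start with a coefficient [h] and end with [x^e].  If
   [v1] and [v2] are two such words, ending with [x^e] and [x^f], and
   [u = x^(e(k+1)) h x^(-f)], then nothing cancels in [v1 u v2 u^-1], which
   therefore lies in the kernel and has degree [deg v1 + deg v2 + 2(k+2)].
   Taking [v1] and [v2] equal yields all large even degrees, and combining a
   word of odd degree with a word of even degree yields all large odd ones.
   Powers of [x] are in the kernel only if [g = 1], as free groups are
   torsion-free, and in that case every positive degree occurs. *)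

Require Import Defs.
From mathcomp Require Import all_boot.
From mathcomp Require Import classical_sets cardinality.
From mathcomp Require boolp.
From mathcomp Require Import zify.

Set Implicit Arguments.
Unset Strict Implicit.
Unset Printing Implicit Defensive.

Section TorsionFree.
Local Open Scope group_scope.
Variable X : choiceType.
Implicit Types (g : freegroup X) (s t : seq (X * bool)).

Lemma fg_cat_word s t : freely_reduced (s ++ t) -> fg_cat s t = s ++ t.
Proof.
elim: s => //= l s IHs rst; rewrite IHs; last exact: path_sorted rst.
by case: (s ++ t) rst => //= m u /andP[/negbTE -> _].
Qed.

(** Nothing cancels where consecutive copies of such a word meet, so its positive powers are plain
    concatenations. *)
Lemma fg_expg_word g k l s : fg_word g = l :: s -> l != flip (last l s) ->
  exists t, fg_word (g ^+ k.+1) = l :: s ++ t.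
Proof.
move=> gE ls; elim: k => [|k [t IHk]].
  by exists [::]; rewrite expg1 cats0.
exists (l :: s ++ t); rewrite expgS /= IHk gE fg_cat_word //.
have := fg_reduced (g ^+ k.+1); have := fg_reduced g.
by rewrite IHk gE /freely_reduced /= !cat_path /= cat_path => -> /= ->; rewrite ls.
Qed.

(** Induction on length: if the end letters of [g] do not cancel cyclically, its positive powers are
    non-empty words; otherwise [g] is a conjugate of a shorter element, whose power is trivial
    too. *)
Lemma fg_torsion_free g k : g ^+ k.+1 = 1 -> g = 1.
Proof.
have [n] := ubnP (size g); elim: n g => // n IHn [s rs] /= sn gk1.
case: s rs sn gk1 => [|l s] rs sn gk1; first exact: val_inj.
have [ls|ls] := eqVneq l (flip (last l s)); last first.
  have [t tE] := @fg_expg_word (FreeGroup rs) k l s erefl ls.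
  by rewrite gk1 in tE.
case/lastP: s rs sn gk1 ls => [|s z] rs sn gk1.
  (* A single letter is never its own inverse. *)
  by case: (l) => i [] [].
rewrite last_rcons => ls.
have rsz : freely_reduced (s ++ [:: z]).
  by rewrite cats1; exact: path_sorted rs.
have rm : freely_reduced s by case/cat_sorted2: rsz.
pose m := FreeGroup rm; pose a := @FreeGroup X [:: l] isT.
have gE : FreeGroup rs = m ^ a^-1.
  rewrite /conjg invgK; apply: val_inj.
  have -> : a^-1 = @FreeGroup X [:: z] isT.
    by apply: val_inj; rewrite /= /fg_winv /= ls flipK.
  rewrite /= (fg_cat_word rsz).
  have := @fg_cat_word [:: l] (s ++ [:: z]); rewrite /= => -> //.
    by rewrite cats1.
  by rewrite cats1.
have m1 : m = 1.
  apply: IHn; first by move: sn; rewrite /= size_rcons; lia.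
  by apply/eqP; rewrite -(conjg_eq1 _ a^-1) conjXg -gE gk1.
by rewrite gE m1 conj1g.
Qed.

End TorsionFree.

Lemma rcons_nseq (T : Type) k (x : T) : rcons (nseq k x) x = nseq k.+1 x.
Proof. by rewrite -cats1 -(nseqD k 1) addn1. Qed.

Section Words.
Local Open Scope group_scope.
Variable H : groupType.
Implicit Types (s t : seq (H + bool)) (v w : equation H).

Lemma eq_reduced_join s l m t :
  eq_reduced (rcons s l) -> can_follow l m -> eq_reduced (m :: t) ->
  eq_reduced (rcons s l ++ m :: t).
Proof.
rewrite /eq_reduced mem_cat negb_or => /andP[-> rs] lm /andP[-> rt] /=.
rewrite sorted_cat_cons; move: rs rt; rewrite -cats1 sorted_cat_cons /= andbT.
by rewrite -[rcons (s ++ _) _]cats1 -catA sorted_cat_cons /= lm andbT => ->.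
Qed.

Lemma cyclic_reduction_fix w : cyclic_step w = w -> cyclic_reduction w = w.
Proof.
move=> fw; apply: val_inj => /=; elim: (size w) => //= n -> //.
Qed.

Lemma degree_fix w : cyclic_step w = w -> degree w = count (@is_var H) w.
Proof. by move=> /cyclic_reduction_fix wE; rewrite /degree wE. Qed.

Lemma count_winv s : count (@is_var H) (eq_winv s) = count (@is_var H) s.
Proof.
by rewrite /eq_winv count_rev count_map; apply: eq_count => -[].
Qed.

Lemma eq_reduced_nseq (e : bool) n : eq_reduced (nseq n (inr e : H + bool)).
Proof.
by elim: n => //= n IHn; rewrite eq_reduced_cons IHn andbT; case: n {IHn} => //=.
Qed.

Lemma eq_reduced_vars s : eq_reduced s -> all (@is_var H) s ->
  exists e, s = nseq (size s) (inr e).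
Proof.
elim: s => [|[//|e] s IHs]; first by exists true.
rewrite eq_reduced_cons => /and3P[_ es rs] /= /(IHs rs)[f sE].
exists e; rewrite sE size_nseq; case: s sE es {rs IHs} => //= m s [-> _] /eqP ->.
by [].
Qed.

(** Rotation 0 checks the linear adjacencies, rotation 1 the pair formed by the last and first
    letters. The length bound excludes a lone coefficient, which [cycle] would compare with
    itself. *)
Lemma cyclically_reduced_cycle s :
  1 < size s -> cyclically_reduced s -> cycle (@can_follow H) s.
Proof.
case: s => // l [//|m s] _ rs.
have := rs 1%N; have := rs 0%N; rewrite rot0 rot1_cons /eq_reduced /=.
by rewrite rcons_path => /andP[_ /andP[-> _]] /andP[_].
Qed.

End Words.

Section Kernel.
Local Open Scope group_scope.
Variables (G : groupType) (H : groupClosed G) (g : G).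
Local Notation K := (subgroup_of H).
Implicit Types (s t : seq (K + bool)).
Local Notation ev s := (\prod_(l <- s) @eval_letter G H g l).

Lemma eval_winv s : ev (eq_winv s) = (ev s)^-1.
Proof.
elim: s => [|l s IHs]; first by rewrite /eq_winv big_nil invg1.
rewrite /eq_winv map_cons rev_cons -cats1 big_cat big_seq1 big_cons invgM.
by rewrite IHs; case: l => [h|[]] //=; rewrite ?invgK // gmulfV.
Qed.

Lemma eval_nseq e n : ev (nseq n (inr e)) = (if e then g else g^-1) ^+ n.
Proof. by elim: n => [|n IHn]; rewrite /= ?big_nil // big_cons IHn expgS. Qed.

(* The prescribed first and last letters make such a word cyclically reduced. *)
Definition relator (e : bool) (d : nat) s :=
  [/\ eq_reduced s, exists h t, s = inl h :: rcons t (inr e), ev s = 1 &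
      count (@is_var K) s = d].

Lemma relator_degree e d s : relator e d s -> ideal_degrees H g d.
Proof.
case=> rs [h [t sE]] s1 sd; exists (Equation rs); split=> //.
  by apply/eqP => /(congr1 (@eq_word _)); rewrite /= sE.
by rewrite degree_fix //= sE cyclic_step_rcons.
Qed.

(** In [s1 u s2 u^-1], [u] prolongs the final [x^e] of [s1] and [u^-1] the final [x^f] of [s2]; the
    coefficient [h1] inside [u] keeps [x^e] from cancelling with [x^(-f)]. The sign changes because
    [u^-1] ends with [x^(-e)]. *)
Lemma relator_conjugate_mul e f d1 d2 s1 s2 k :
  relator e d1 s1 -> relator f d2 s2 ->
  exists s, relator (~~ e) (d1 + d2 + (k + 2).*2) s.
Proof.
case=> r1 [h1 [t1 E1]] v1 c1 [r2 [h2 [t2 E2]] v2 c2].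
have h11 : h1 != 1.
  by move: r1; rewrite E1 eq_reduced_cons => /andP[].
have ru' : eq_reduced (rcons (nseq k (inr e)) (inr e) ++ [:: inl h1]).
  apply: eq_reduced_join => //; first by rewrite rcons_nseq; exact: eq_reduced_nseq.
  by rewrite eq_reduced_cons /= inlE h11.
pose a := nseq k (inr e) ++ [:: inl h1 : K + bool].
pose u := inr e :: rcons a (inr (~~ f)).
have uE : u = rcons (rcons (nseq k (inr e)) (inr e)) (inl h1) ++ [:: inr (~~ f)].
  by rewrite rcons_nseq /u /a !cats1.
have ru : eq_reduced u by rewrite uE eq_reduced_join // -cats1.
have VE : eq_winv u = inr f :: rcons (eq_winv a) (inr (~~ e)).
  by rewrite /u /eq_winv /= rev_cons map_rcons rev_rcons /= negbK.
have rV := eq_winv_reduced ru.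
have r2V : eq_reduced (s2 ++ eq_winv u).
  by rewrite E2 VE -rcons_cons; apply: eq_reduced_join; rewrite ?rcons_cons -?E2 -?VE //=.
have ru2V : eq_reduced (u ++ s2 ++ eq_winv u).
  rewrite {1}/u -rcons_cons E2 cat_cons; apply: eq_reduced_join => //.
  by rewrite -cat_cons -E2.
exists (s1 ++ u ++ s2 ++ eq_winv u); split.
- rewrite E1 -rcons_cons; apply: eq_reduced_join; rewrite ?rcons_cons -?E1 //=.
- exists h1, (rcons t1 (inr e) ++ u ++ s2 ++ inr f :: eq_winv a).
  by rewrite VE E1 !rcons_cat.
- by rewrite !big_cat v1 v2 eval_winv /= !mul1g mulgV.
- rewrite !count_cat c1 c2 count_winv /u /a -cats1 /= !count_cat /= count_nseq /=.
  lia.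
Qed.

Lemma ideal_degrees1 d : g = 1 -> ideal_degrees H g d.+1.
Proof.
move=> g1; exists (Equation (eq_reduced_nseq _ true d.+1)); split=> //.
  by rewrite /ideal /mkset /eval eval_nseq g1 expg1n.
have cE : count (@is_var K) (nseq d.+1 (inr true)) = d.+1.
  by rewrite count_nseq mul1n.
rewrite degree_fix //.
case: d {cE} => [//|d]; rewrite [LHS](_ : _ = cyclic_step (inr true :: nseq d.+1 (inr true))) //.
by rewrite -rcons_nseq cyclic_step_rcons eqxx rcons_nseq.
Qed.

(** The relator is a rotation of the cyclic reduction of [w], which remains in the kernel, being a
    conjugate of [w]. *)
Lemma relator_exists w : (forall k, g ^+ k.+1 = 1 -> g = 1) -> g <> 1 ->
  ideal (H := H) g w -> w != 1 ->
  exists e s, relator e (degree w) s.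
Proof.
move=> tfg g1 w1 wn1; have [y yE] := cyclic_reduction_conj w.
pose v := cyclic_reduction w; rewrite -/v in yE.
have rv : cyclically_reduced v := cyclic_reductionP w.
have v1 : ev v = 1.
  have : eval g (w ^ y) = eval g w ^ eval g y := gmulfJ _ w y.
  by rewrite -yE [eval g w]w1 conj1g.
have vn1 : v != 1 by rewrite yE conjg_eq1.
(* Without [x], a non-trivial reduced word is a single coefficient, and [H] embeds in [G]. *)
have hasx : has (@is_var K) v.
  case: v v1 vn1 {yE rv} => [[|[h|e] [|[k|f] s]] rs] //= v1.
  - have h1 : eval_letter g (inl h) = eval_letter g (inl (1 : K)).
      by move: v1; rewrite big_seq1 => ->; rewrite eval_letter1.
    by move: rs; rewrite eq_reduced_cons inlE (val_inj h1) eqxx.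
  - by move: rs; rewrite eq_reduced_cons /= andbF.
have hasH : ~~ all (@is_var K) v.
  apply/negP => /(eq_reduced_vars (eq_reducedP v))[e vE].
  move: v1; rewrite vE eval_nseq; case: (size v) hasx vE => [|k _ _].
    by move=> hasx vE; rewrite vE in hasx.
  case: e => [/tfg //|]; rewrite expVgn => /eqP; rewrite invg_eq1 => /eqP.
  by move/tfg.
have szv : 1 < size v by case: (eq_word v) hasx hasH => [|l [|m s]] //=; case: is_var.
have := cyclically_reduced_cycle szv rv.
case/allPn: hasH => -[h|//] /rot_to[i s vE] _.
rewrite -(rot_cycle i) vE; have := size_rot i v; rewrite vE.
(* A final coefficient would be cyclically adjacent to [h]. *)
case/lastP: s vE => [|s [k|e]] vE; first by move=> sv; rewrite -sv in szv.
  by rewrite /= !rcons_path last_rcons andbF.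
move=> _ _; exists e, (rot i v); split; first exact: rv.
- by exists h, s.
(* If a product [ab] is 1, so is [ba]. *)
- move: v1; rewrite -{1}(cat_take_drop i v) /rot !big_cat /= => /eqP.
  by rewrite mulg_eq1 => /eqP ->; rewrite mulgV.
- by apply/permP; rewrite perm_rot.
Qed.

End Kernel.

Local Open Scope classical_set_scope.

Theorem theorem3 (n : nat) (H : groupClosed (freegroup 'I_n))
    (g : freegroup 'I_n) :
  finitely_generated H -> depends_on H g ->
  let D := ideal_degrees H g in
  let case_i := (exists2 d, D d & odd d) /\ finite_set (~` D) in
  let case_ii := (forall d, D d -> ~~ odd d) /\
                 finite_set ([set d | ~~ odd d] `\` D) in
  (case_i /\ ~ case_ii) \/ (~ case_i /\ case_ii).
Proof.
move=> _ [w w1 wn1] D case_i case_ii.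
have cofinite (P : set nat) N : (forall d, N <= d -> P d -> D d) ->
    finite_set (P `\` D).
  move=> ND; apply: sub_finite_set (finite_II N) => d [Pd nDd] /=.
  by rewrite ltnNge; apply/negP => /ND /(_ Pd).
have [g1|/eqP g1] := eqVneq g 1%g.
  have Dpos d : 1 <= d -> True -> D d.
    case: d => // d _ _; exact: ideal_degrees1.
  left; split.
    split; first by exists 1; first exact: Dpos.
    by rewrite -setTD; apply: cofinite Dpos.
  by case=> /(_ 1 (Dpos 1 isT I)).
have tfg k := @fg_torsion_free _ g k.
have [e [s]] := relator_exists tfg g1 w1 wn1; move: (degree w) => c rs.
(* Joining [s] to itself with parameter [k] gives degree [2(c + k + 2)], so [k = m - (c + 2)]. *)
have even_relator m : c + 2 <= m -> exists s, relator (H := H) g (~~ e) m.*2 s.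
  move=> mw; have [t] := relator_conjugate_mul (m - (c + 2)) rs rs.
  by rewrite (_ : _ + _ = m.*2); [exists t | lia].
have even_cofinite : finite_set ([set d | ~~ odd d] `\` D).
  apply: (cofinite _ (c + 2).*2) => d dw /= od.
  have [|t] := even_relator d./2; first by lia.
  by rewrite even_halfK //; apply: relator_degree.
have [[d [v [v1 vn1 vd]] od]|no_odd] := boolp.EM (exists2 d, D d & odd d).
  have Dd : D d by exists v.
  left; split; last by case=> /(_ d Dd); rewrite od.
  split; first by exists d.
  have := relator_exists tfg g1 v1 vn1; rewrite vd => -[f [t rt]].
  have [t' rt'] := even_relator _ (leqnn _).
  pose N := (d + (c + 2).*2)%N.
  have odd_cofinite : finite_set ([set d | odd d] `\` D).
    (* Joining [t] to [t'] with parameter [j] gives degree [N + 2(j + 2)], hence the bound [N + 4];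
       [k - N] is even since both are odd. *)
    apply: (cofinite _ (N + 4)) => k Nk /= ok.
    have [u] := relator_conjugate_mul ((k - N)./2 - 2) rt rt'.
    rewrite -/N (_ : N + _ = k); first exact: relator_degree.
    have oN : odd N by rewrite /N oddD od odd_double.
    lia.
  rewrite -setTD (_ : setT = [set d | ~~ odd d] `|` [set d | odd d]).
    by rewrite setDUl finite_setU.
  by apply/seteqP; split=> // k _ /=; case: odd; [right | left].
right; split; first by case.
by split=> // d Dd; apply/negP => od; apply: no_odd; exists d.
Qed.
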